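(* Let $q$ be a prime power and let $t$ be an integer with $t=5$ or $t>6$. Then any linear set $L$ of pseudoregulus type in $\mathrm{PG}(1,q^t)$ can be obtained as the projection of two different subgeometries from the same center to the same axis, with no collineation fixing the center and mapping one subgeometry to the other. Precisely: let $\Sigma^*=\mathrm{PG}(t-1,q^t)$, and identify $\mathrm{PG}(1,q^t)$ with a line $\Lambda$ of $\Sigma^*$, so that $L\subset\Lambda$. Then there exist a $(t-3)$-dimensional projective subspace $\Gamma$ of $\Sigma^*$ disjoint from $\Lambda$ and two different canonical subgeometries $\Sigma_1\cong\Sigma_2\cong\mathrm{PG}(t-1,q)$ of $\Sigma^*$, both disjoint from $\Gamma$, such that $$p_{\Gamma,\Lambda}(\Sigma_1)=L=p_{\Gamma,\Lambda}(\Sigma_2),$$ and there exists no collineation $\phi$ of $\Sigma^*$ with $\Gamma^{\phi}=\Gamma$ and $\Sigma_1^{\phi}=\Sigma_2$.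
   Context: For a vector space $V$ over a finite field $F$, the points of the associated projective space are the one-dimensional $F$-subspaces of $V$; $\langle v\rangle_{q^t}$ denotes the point spanned by a nonzero vector $v$ over $\mathbb{F}_{q^t}$. All dimensions of projective subspaces are projective dimensions. A collineation of a projective space is a bijection of its points induced by an invertible semilinear map of the underlying vector space; a projectivity is one induced by an invertible linear map. Canonical subgeometry: let $V$ be an $n$-dimensional vector space over $\mathbb{F}_{q^t}$ and let $W\subset V$ be an $\mathbb{F}_q$-subspace with $\dim_{\mathbb{F}_q}W=n$ whose $\mathbb{F}_{q^t}$-span is $V$. Then $\{\langle w\rangle_{q^t}: w\in W\setminus\{0\}\}$ is a canonical subgeometry (of order $q$) of $\mathrm{PG}(n-1,q^t)$; it is isomorphic to $\mathrm{PG}(n-1,q)$. Projection: if $\Sigma'$ is a canonical subgeometry of $\Sigma^*=\mathrm{PG}(n-1,q^t)$, $\Gamma\subset\Sigma^*\setminus\Sigma'$ is an $(n-1-r)$-subspace, and $\Lambda\subset\Sigma^*\setminus\Gamma$ is an $(r-1)$-subspace, then $p_{\Gamma,\Lambda}(\Sigma')=\{\langle\Gamma,P\rangle\cap\Lambda: P\in\Sigma'\}$ is the projection of $\Sigma'$ from center $\Gamma$ to axis $\Lambda$. Linear set of pseudoregulus type: a point set of $\mathrm{PG}(1,q^t)$, $t\ge 2$, which is projectively equivalent (i.e. equivalent under a projectivity) to $\mathbb{L}=\{\langle(\lambda,\lambda^q)\rangle_{q^t}:\lambda\in\mathbb{F}_{q^t}^*\}$. *)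

(* Defs.v *)
From HB Require Import structures.
From mathcomp Require Import all_boot all_order all_algebra all_field.
From mathcomp Require Import boolp classical_sets functions.

Set Implicit Arguments.
Unset Strict Implicit.
Unset Printing Implicit Defensive.

Import GRing.Theory VectorInternalTheory.
Local Open Scope ring_scope.
Local Open Scope classical_set_scope.

(* The field extension F_{q^t} / F_q is K : fieldExtType F, with F a finite
   field of order q = #|F| and \dim {:K} = t.  PG(n - 1, q^t) is the
   projective space of a V : vectType K with \dim {:V} = n; its points are the
   U : {vspace V} of vector dimension 1, and point sets have type
   set {vspace V}. *)

(* V viewed as a vector space over F by restriction of scalars. *)
Definition restr_scalars (F : fieldType) (K : fieldExtType F)
  (V : vectType K) : Type := V.

Section RestrictScalars.

Variables (F : fieldType) (K : fieldExtType F) (V : vectType K).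

Notation VF := (restr_scalars V).

HB.instance Definition _ := GRing.Zmodule.copy VF V.

Definition restr_scale (a : F) (v : VF) : VF := (a%:A : K) *: (v : V).

Fact restr_scaleA a b v :
  restr_scale a (restr_scale b v) = restr_scale (a * b) v.
Proof. by rewrite /restr_scale scalerA -scalerAl mul1r scalerA. Qed.

Fact restr_scale1 : left_id 1 restr_scale.
Proof. by move=> v; rewrite /restr_scale scale1r scale1r. Qed.

Fact restr_scaleDr : right_distributive restr_scale +%R.
Proof. by move=> a u v; apply: scalerDr. Qed.

Fact restr_scaleDl v : {morph restr_scale^~ v : a b / a + b}.
Proof. by move=> a b; rewrite /restr_scale scalerDl scalerDl. Qed.

HB.instance Definition _ := GRing.Zmodule_isLmodule.Build F VF
  restr_scaleA restr_scale1 restr_scaleDr restr_scaleDl.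

Lemma restr_scaleE (a : F) (v : V) : a *: (v : VF) = (a%:A : K) *: v.
Proof. by []. Qed.

Fact restr_vect_iso : Vector.axiom (dim V * dim K) VF.
Proof.
exists (fun v : VF => mxvec (\matrix_(i, j) v2r (v2r (v : V) 0 i : K) 0 j)).
  move=> a u v; rewrite -linearP; congr mxvec; apply/matrixP=> i j.
  rewrite !mxE (linearP (@v2r K V)) !mxE -scalerAl mul1r.
  by rewrite (linearP (@v2r F K)) !mxE.
exists (fun w => r2v (\row_i (r2v (row i (vec_mx w)) : K)) : V) => [v|w].
  apply: (canLR v2rK); apply/rowP=> i; rewrite !mxE mxvecK.
  by apply: (canLR v2rK); apply/rowP=> j; rewrite !mxE.
apply: (canLR vec_mxK); apply/matrixP=> i j.
by rewrite !mxE r2vK mxE r2vK !mxE.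
Qed.

HB.instance Definition _ := Lmodule_hasFinDim.Build F VF restr_vect_iso.

End RestrictScalars.

Section ProjectiveSpace.

Variables (K : fieldType) (V : vectType K).

(* U has projective dimension d. *)
Definition has_pdim (d : nat) (U : {vspace V}) := \dim U = d.+1.

Definition points (U : {vspace V}) : set {vspace V} :=
  [set P | has_pdim 0 P /\ (P <= U)%VS].

(* phi is a bijection on points induced by f; the value of phi at subspaces
   that are not points is irrelevant. *)
Definition induced_by (f : V -> V) (phi : {vspace V} -> {vspace V}) :=
  set_bij (points fullv) (points fullv) phi /\
  forall v, v != 0 -> phi <[v]>%VS = <[f v]>%VS.

Definition collineation (phi : {vspace V} -> {vspace V}) :=
  exists (sigma : {rmorphism K -> K}) (f : {linear V -> V | sigma \; *:%R}),
    [/\ bijective sigma, bijective f & induced_by f phi].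

Definition projectivity (phi : {vspace V} -> {vspace V}) :=
  exists f : {linear V -> V}, bijective f /\ induced_by f phi.

(* p_{Gamma,Lambda}(S) *)
Definition projection (Gamma Lambda : {vspace V}) (S : set {vspace V}) :
    set {vspace V} :=
  [set ((Gamma + P) :&: Lambda)%VS | P in S].

End ProjectiveSpace.

(* A K-subspace contains the K-span of W iff it contains W, so the second
   conjunct says that the K-span of W is V. *)
Definition canonical_subgeometry (F : fieldType) (K : fieldExtType F)
    (V : vectType K) (S : set {vspace V}) :=
  exists W : {vspace restr_scalars V},
    [/\ \dim W = \dim {:V},
        forall U : {vspace V}, (forall w : V, w \in W -> w \in U) ->
          U = fullv
      & S = [set <[w : V]>%VS | w in [set w : V | w \in W /\ w != 0]]].

Section PseudoregulusType.

Variables (F : finFieldType) (K : fieldExtType F).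

(* {<(lambda, lambda^q)> : lambda in K^*} with q = #|F| *)
Definition pseudoregulus_model : set {vspace 'rV[K]_2} :=
  [set <[\row_(i < 2) [:: l; l ^+ #|F|]`_i]>%VS | l in [set l : K | l != 0]].

Definition pseudoregulus_type (L : set {vspace 'rV[K]_2}) :=
  exists2 phi, projectivity phi & phi @` pseudoregulus_model = L.

End PseudoregulusType.

(* Main.v *)
Require Import Defs.
From HB Require Import structures.
From mathcomp Require Import all_boot all_order all_algebra all_field.
From mathcomp Require Import boolp classical_sets functions.
From mathcomp Require Import pgroup abelian zify.

Set Implicit Arguments.
Unset Strict Implicit.
Unset Printing Implicit Defensive.

Import GRing.Theory.
Local Open Scope ring_scope.
Local Open Scope classical_set_scope.

(** With q = #|F| and t = dim K, take a basis (B_i) of V such that B_0, B_1 span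
    Lambda and L' = {<x B_0 + x^q B_1>}, and let Gamma be the span of the other
    B_i.  For s coprime to t, the vectors f_s(x) = sum_i x^(q^(si)) B_i form a
    canonical subgeometry Sigma_s, whose projection {<x B_0 + x^(q^s) B_1>} does
    not depend on s: x^(q-1) and x^(q^s-1) range over the same elements of K^*.
    For 1 < s < t - 1 compare Sigma_1 and Sigma_s.

    Let a collineation induced by a sigma-semilinear f fix Gamma and map Sigma_1
    to Sigma_s.  Raising the coordinates of f(f_1(x)) to the power q^s multiplies
    them, up to a cyclic shift, by a scalar gamma, and additivity forces gamma to
    be independent of x.  With y = sigma(x), the first two coordinates of
    f(f_1(x)) have the form a y + b y^q and c y + d y^q, hence
    (a y + b y^q)^(q^s) = gamma (c y + d y^q) for all y.  The exponents 1, q,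
    q^s, q^(s+1) are distinct and less than |K|, so a = b = 0, and f is not
    surjective. *)

(** * Choice of the step s *)

Lemma exists_coprime_step (t : nat) : t = 5 \/ (6 < t)%N ->
  exists s, [/\ (1 < s)%N, (s.+1 < t)%N & coprime s t].
Proof.
case=> [->|t_gt6]; first by exists 2.
have [t_odd|t_even] := boolP (odd t).
  by exists 2; split=> //; [lia | rewrite coprime2n].
have [m tE] : exists m, t = (2 * m)%N by exists t./2; lia.
(* For t = 2m, gcd(m - 2, t) divides 4 and gcd(m - 1, t) divides 2, so whichever of m - 2, m - 1 is
   odd is coprime to t; it exceeds 1 because m > 3. *)
have [m_odd|m_even] := boolP (odd m).
  exists (m - 2)%N; split; [lia | lia | rewrite tE].
  have -> : (2 * m)%N = (m - 2 + (m - 2 + 2 ^ 2))%N by lia.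
  by rewrite /coprime !gcdnDl -/(coprime _ _) coprimeXr // coprimen2; lia.
exists (m - 1)%N; split; [lia | lia | rewrite tE].
have -> : (2 * m)%N = (m - 1 + (m - 1 + 2))%N by lia.
by rewrite /coprime !gcdnDl -/(coprime _ _) coprimen2; lia.
Qed.

Lemma coprime_mod_inj s n : coprime s n ->
  injective (fun i : 'I_n => (s * i) %% n)%N.
Proof.
move=> co_s i j /= /eqP.
wlog le_ji : i j / (j <= i)%N.
  move=> W; case/orP: (leq_total j i) => [/W //|/W ji]; rewrite eq_sym => /ji.
  exact: esym.
rewrite eqn_mod_dvd ?leq_mul2l ?le_ji ?orbT // -mulnBr Gauss_dvdr; last first.
  by rewrite coprime_sym.
move=> dvd_ij; apply/val_inj/eqP; rewrite eqn_leq le_ji andbT -subn_eq0.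
case: posnP => // ij_gt0; have := dvdn_leq ij_gt0 dvd_ij.
by rewrite leqNgt (leq_ltn_trans (leq_subr _ _) (ltn_ord i)).
Qed.

Lemma line_scale (K : fieldType) (V : vectType K) (k : K) (v : V) :
  k != 0 -> <[k *: v]>%VS = <[v]>%VS.
Proof.
move=> k_neq0; apply/eqP; rewrite eqEsubv -!memvE memvZ ?memv_line //=.
by rewrite -{1}[v](scalerK k_neq0) memvZ ?memv_line.
Qed.

(** * Frobenius powers and linearized polynomials *)

Section Frobenius.

Variables (F : finFieldType) (K : fieldExtType F).

Notation q := #|F|.
Notation t := (\dim {:K}).

Implicit Types (x y : K) (i j k : nat).

Lemma exprqM x i j : x ^+ (q ^ i) ^+ (q ^ j) = x ^+ (q ^ (i + j)).
Proof. by rewrite -exprM -expnD. Qed.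

Lemma exprq_fix k x : x ^+ q = x -> x ^+ (q ^ k) = x.
Proof.
by move=> xq; elim: k => [|k IHk]; rewrite ?expr1 // expnSr exprM IHk.
Qed.

Lemma exprqD k x y : (x + y) ^+ (q ^ k) = x ^+ (q ^ k) + y ^+ (q ^ k).
Proof.
have [p p_pr pcharF] := finPcharP F; apply: exprDn_pchar.
(* The additive group of F is a p-group, so q is a power of p. *)
have /abelem_pgroup := fin_ring_pchar_abelem pcharF.
rewrite /pgroup cardsT pnatX => /sub_in_pnat -> // r _ /eqP ->.
by rewrite (pchar_lalg K).
Qed.

Lemma exprqZ k (a : F) x : (a *: x) ^+ (q ^ k) = a *: x ^+ (q ^ k).
Proof.
rewrite exprZn; congr (_ *: _).
by elim: k => [|k IHk]; rewrite ?expr1 // expnSr exprM IHk expf_card.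
Qed.

Lemma exprq_eq0 k x : (x ^+ (q ^ k) == 0) = (x == 0).
Proof. by rewrite expf_eq0 expn_gt0 (ltnW (finNzRing_gt1 F)). Qed.

Lemma exprq_dim x : x ^+ (q ^ t) = x.
Proof. by apply/eqP; rewrite -(Fermat's_little_theorem {:K}%AS) memvf. Qed.

Lemma exprq_mod k x : x ^+ (q ^ (k %% t)) = x ^+ (q ^ k).
Proof.
rewrite [in RHS](divn_eq k t) addnC -exprqM mulnC.
elim: (k %/ t)%N (x ^+ _) => [|m IHm] y; first by rewrite muln0 expr1.
by rewrite mulnS -exprqM exprq_dim.
Qed.

(** Otherwise the sum of the a_i X^(q^(h i)) would be a nonzero polynomial of degree less than q^t =
    |K| with all of K as roots; injectivity of [h] keeps its monomials apart. *)
Lemma linearized_eq0 (I : finType) (h : I -> nat) (a : I -> K) :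
    injective h -> (forall i : I, h i < t)%N ->
    (forall x, \sum_i a i * x ^+ (q ^ h i) = 0) ->
  forall i : I, a i = 0.
Proof.
move=> h_inj h_lt a0 i.
pose p : {poly K} := \sum_i a i *: 'X^(q ^ h i).
suff p0 : p = 0.
  have := coef0 K (q ^ h i); rewrite -p0 coef_sum (bigD1 i) //=.
  rewrite coefZ coefXn eqxx mulr1 big1 ?addr0 // => j ji.
  rewrite coefZ coefXn eqn_exp2l ?finNzRing_gt1 //.
  by rewrite (inj_eq h_inj) eq_sym (negPf ji) mulr0.
apply/eqP/contraT => p_neq0.
pose rs : seq K := enum (finvect_type K).
have rs_size : size rs = (q ^ t)%N.
  by rewrite -(card_vspace {:finvect_type K}) card_vspacef cardE.
have rs_root : all (root p) rs.
  apply/allP=> x _; rewrite rootE horner_sum; apply/eqP; rewrite -[RHS](a0 x).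
  by apply: eq_bigr => j _; rewrite hornerZ hornerXn.
have := max_poly_roots p_neq0 rs_root (enum_uniq _).
rewrite rs_size ltnNge => /negP[].
apply: leq_trans (size_sum _ _ _) _; apply/bigmax_leqP => j _.
apply: leq_trans (size_scale_leq _ _) _; rewrite size_polyXn.
by rewrite ltn_exp2l ?finNzRing_gt1.
Qed.

(* For y = x^(1 + q^m + ... + q^(m(n-1))) one has y^(q^m) x = y x^(q^(mn)). *)
Lemma exprq_ratio m n x : x != 0 ->
  exists y c, [/\ y != 0, c != 0, x = c * y &
                  x ^+ (q ^ (m * n)) = c * y ^+ (q ^ m)].
Proof.
move=> x_neq0; pose y := \prod_(0 <= i < n) x ^+ (q ^ (m * i)).
have y_neq0 : y != 0.
  by rewrite prodf_seq_neq0; apply/allP=> i _; rewrite exprq_eq0.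
have yE : y ^+ (q ^ m) * x = y * x ^+ (q ^ (m * n)).
  rewrite -[RHS](big_nat_recr n _ (fun i => x ^+ (q ^ (m * i)))) //=.
  rewrite big_nat_recl // muln0 expr1 mulrC; congr (_ * _).
  rewrite -prodrXl; apply: eq_bigr => i _.
  by rewrite exprqM mulnS addnC.
exists y, (x / y); split=> //; first by rewrite mulf_neq0 ?invr_eq0.
  by rewrite divfK.
by rewrite mulrAC [x * _]mulrC yE mulrAC divff ?mul1r.
Qed.

End Frobenius.

(** * The subgeometries Sigma_s *)

Section TwistedSubgeometry.

Variables (F : finFieldType) (K : fieldExtType F) (V : vectType K) (n : nat).
Variable B : n.+2.-tuple V.
Hypothesis dimK : \dim {:K} = n.+2.
Hypothesis basisB : basis_of {:V} B.

Notation q := #|F|.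
Implicit Types (x y : K) (s : nat).

Definition twist s x : V := \sum_(i < n.+2) x ^+ (q ^ (s * i)) *: B`_i.

Definition twisted_subgeometry s : set {vspace V} :=
  [set <[twist s x]>%VS | x in [set x | x != 0]].

Lemma coord_twist s x (i : 'I_n.+2) :
  coord B i (twist s x) = x ^+ (q ^ (s * i)).
Proof. exact: coord_sum_free (basis_free basisB). Qed.

Lemma coord_inj u v : (forall i, coord B i u = coord B i v) -> u = v.
Proof.
move=> uv; rewrite (coord_basis basisB (memvf u)) (coord_basis basisB (memvf v)).
by apply: eq_bigr => i _; rewrite uv.
Qed.

Lemma twist_is_linear s : linear (twist s : K -> restr_scalars V).
Proof.
move=> a x y; apply: coord_inj => i.
rewrite restr_scaleE linearP /= !coord_twist exprqD exprqZ.
by rewrite -scalerAl mul1r.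
Qed.

HB.instance Definition _ s := GRing.isLinear.Build F K (restr_scalars V) *:%R
  (twist s : K -> restr_scalars V) (twist_is_linear s).

Lemma twist_eq0 s x : (twist s x == 0) = (x == 0).
Proof.
apply/eqP/eqP => [fx0|->]; last first.
  by apply: coord_inj => i; apply/eqP; rewrite coord_twist linear0 exprq_eq0.
by have := coord_twist s x ord0; rewrite fx0 linear0 muln0 expr1.
Qed.

(** The projector [p] with kernel U kills every [twist s x]. In each coordinate this is a linearized
    polynomial in x vanishing on K, so [p] kills every B_i. *)
Lemma twist_spans s (U : {vspace V}) : coprime s n.+2 ->
  (forall x, twist s x \in U) -> U = fullv.
Proof.
move=> co_s memU; pose p := (\1 - projv U)%VF.
suff pB0 (i : 'I_n.+2) : p B`_i = 0.
  apply/eqP; rewrite eqEsubv subvf /= -(span_basis basisB).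
  apply/span_subvP => _ /tnthP[i ->]; rewrite (tnth_nth 0).
  have /eqP := pB0 i; rewrite add_lfunE opp_lfunE id_lfunE subr_eq0 => /eqP->.
  exact: memv_proj.
apply: coord_inj => j; rewrite linear0; move: i.
(* Reducing the exponents s i modulo t leaves the powers unchanged and brings them below t; they
   stay distinct as s is coprime to t. *)
apply: (linearized_eq0
  (h := fun i : 'I_n.+2 => (s * i) %% n.+2)%N).
- exact: coprime_mod_inj.
- by move=> i; rewrite dimK ltn_mod.
move=> x; have : p (twist s x) = 0.
  by rewrite add_lfunE opp_lfunE id_lfunE projv_id ?subrr.
move/(congr1 (coord B j)); rewrite !linear_sum /= linear0 => {2}<-.
apply: eq_bigr => i _; rewrite linearZ /= linearZ /= mulrC.
by have := exprq_mod (s * i) x; rewrite dimK => ->.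
Qed.

Lemma twisted_canonical s : coprime s n.+2 ->
  canonical_subgeometry (twisted_subgeometry s).
Proof.
move=> co_s; pose f := linfun (twist s : K -> restr_scalars V).
exists (limg f); split.
- rewrite limg_dim_eq ?dimK ?(size_basis basisB) //.
  apply/eqP; rewrite -subv0; apply/subvP => x; rewrite memv_cap memv_ker lfunE.
  by rewrite memv0 /= twist_eq0 => /andP[].
- move=> U memU; apply: (@twist_spans s) => // x; apply: memU.
  by have := memv_img f (memvf x); rewrite lfunE.
apply/seteqP; split=> P /=.
  move=> [x x_neq0 <-]; exists (twist s x) => //; split; last by rewrite twist_eq0.
  by have := memv_img f (memvf x); rewrite lfunE.
move=> [w [/memv_imgP[x _ ->]]]; rewrite lfunE /= twist_eq0 => x_neq0 <-.
by exists x.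
Qed.

(** * Center, axis and projection *)

Definition axis : {vspace V} := <<take 2 B>>%VS.
Definition center : {vspace V} := <<drop 2 B>>%VS.

Lemma center_cap_axis : (center :&: axis)%VS = 0%VS.
Proof.
have := basis_free basisB; rewrite -[X in free X](cat_take_drop 2) cat_free.
by case/and3P => _ _ /directv_addP; rewrite capvC.
Qed.

Lemma coord_center (i : 'I_n.+2) v : (i < 2)%N -> v \in center ->
  coord B i v = 0.
Proof.
move=> i_lt2 /(@coord_span _ _ _ (in_tuple (drop 2 B))) ->.
rewrite linear_sum big1 // => j _; rewrite linearZ /= nth_drop.
have j2_lt : (2 + j < n.+2)%N.
  have := ltn_ord j.
  by rewrite [X in (_ < X)%N -> _]size_drop size_tuple; lia.
rewrite (coord_free (Ordinal j2_lt) _ (basis_free basisB)).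
by rewrite -val_eqE /= gtn_eqF ?mulr0 // ltn_addr.
Qed.

Lemma basis_center (i : 'I_n.+2) : (1 < i)%N -> B`_i \in center.
Proof.
move=> i_gt1; apply: memv_span; rewrite -(subnKC i_gt1) -nth_drop.
by have i_lt := ltn_ord i; rewrite mem_nth // size_drop size_tuple; lia.
Qed.

Lemma twist_center s x : twist s x \in center -> x = 0.
Proof.
move=> fx_center; have := coord_twist s x ord0.
by rewrite coord_center // muln0 expr1.
Qed.

(** The component of [twist s x] in the axis along the center; for s = 1 it is the pseudoregulus
    model in the coordinates B_0, B_1. *)
Definition axis_vec s x : V := x *: B`_0 + x ^+ (q ^ s) *: B`_1.

Lemma axis_vec_in s x : axis_vec s x \in axis.
Proof.
have B_axis i : (i < 2)%N -> B`_i \in axis.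
  move=> i_lt2; rewrite /axis; apply: memv_span.
  by rewrite -(nth_take _ i_lt2) mem_nth // size_takel // size_tuple.
by rewrite memvD ?memvZ ?B_axis.
Qed.

Lemma twist_decomp s x : twist s x - axis_vec s x \in center.
Proof.
have -> : twist s x = axis_vec s x +
    \sum_(i < n) x ^+ (q ^ (s * i.+2)) *: B`_i.+2.
  by rewrite /twist 2!big_ord_recl addrA muln0 expr1 muln1.
rewrite addrC addKr; apply: memv_suml => i _; apply: memvZ.
exact: (basis_center (i := lift ord0 (lift ord0 i))).
Qed.

(** Modulo the center, [twist s x] equals [axis_vec s x], so each spans the same subspace with it;
    the modular law then leaves only the axis vector. *)
Lemma project_twist s x :
  ((center + <[twist s x]>) :&: axis)%VS = <[axis_vec s x]>%VS.
Proof.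
have -> : (center + <[twist s x]>)%VS = (<[axis_vec s x]> + center)%VS.
  have fx_axis := twist_decomp s x; apply/eqP; rewrite eqEsubv !subv_add.
  rewrite addvSl addvSr andbT andTb -!memvE; apply/andP; split.
    by rewrite -(subrKC (axis_vec s x) (twist s x)) memv_add ?memv_line.
  rewrite -(subKr (twist s x) (axis_vec s x)) addrC memv_add ?memv_line //.
  by rewrite memvN.
by rewrite -vspace_modl -?memvE ?axis_vec_in // center_cap_axis addv0.
Qed.

Lemma projection_twisted s :
  projection center axis (twisted_subgeometry s) =
  [set <[axis_vec s x]>%VS | x in [set x | x != 0]].
Proof.
apply/seteqP; split=> [_ [_ [x x_neq0 <-] <-] | _ [x x_neq0 <-]].
  by exists x => //; rewrite project_twist.
by exists <[twist s x]>%VS; [exists x | rewrite project_twist].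
Qed.

Lemma axis_points_sub m k :
  [set <[axis_vec (m * k) x]>%VS | x in [set x | x != 0]] `<=`
  [set <[axis_vec m x]>%VS | x in [set x | x != 0]].
Proof.
move=> _ [x /= /(exprq_ratio m k) [y [c [y_neq0 c_neq0 xE xqE]]] <-].
exists y => //; rewrite -(line_scale _ c_neq0).
by rewrite /axis_vec xqE {1}xE scalerDr !scalerA.
Qed.

Lemma axis_points_coprime s : (0 < s)%N -> coprime s n.+2 ->
  [set <[axis_vec s x]>%VS | x in [set x | x != 0]] =
  [set <[axis_vec 1 x]>%VS | x in [set x | x != 0]].
Proof.
move=> s_gt0 /(coprimeP _ s_gt0)[[r k] /= rkE].
apply/seteqP; split; first by rewrite -{1}[s]mul1n; apply: axis_points_sub.
(* Exponents of q count modulo t, where s r = 1, so 1 is in turn a multiple of s. *)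
have axis_vec_r : axis_vec 1 = axis_vec (s * r).
  apply/funext => x; rewrite /axis_vec -(exprq_mod (s * r)) dimK.
  have -> : (s * r = 1 + k * n.+2)%N by lia.
  by rewrite addnC modnMDl modn_small.
by rewrite axis_vec_r; apply: axis_points_sub.
Qed.

Lemma twisted_center_disjoint s : twisted_subgeometry s `&` points center = set0.
Proof.
apply/seteqP; split=> // _ [[x /= x_neq0 <-] [_]].
by rewrite -memvE => /twist_center x0; rewrite x0 eqxx in x_neq0.
Qed.

(** * Obstruction to a collineation *)

Lemma twistD s x y : twist s (x + y) = twist s x + twist s y.
Proof. by apply: coord_inj => i; rewrite [RHS]linearD /= !coord_twist exprqD. Qed.

(* A multiple of a vector of the [s]-th subgeometry is an eigenvector of the
   semilinear map that raises coordinates to the power [q ^ s] and shifts them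
   cyclically. *)
Definition twist_eigen s (gamma : K) (u : V) : Prop :=
  forall i, coord B i u ^+ (q ^ s) = gamma * coord B (ordS i) u.

Lemma twist_eigen_scale s c y :
  twist_eigen s (c ^+ (q ^ s) / c) (c *: twist s y).
Proof.
move=> i; rewrite !linearZ /= !coord_twist exprMn exprqM.
(* At the last index the shift wraps around to 0, which is consistent because y^(q^t) = y. *)
have -> : y ^+ (q ^ (s * (i.+1 %% n.+2))) = y ^+ (q ^ (s * i + s)).
  have := exprq_mod (s * (i.+1 %% n.+2)) y; rewrite dimK => <-.
  rewrite modnMmr; have := exprq_mod (s * i.+1) y; rewrite dimK => ->.
  by rewrite mulnSr.
(* For c = 0 the eigenvalue is 0 / 0 = 0 and both sides vanish. *)
rewrite mulrA; have [->|c_neq0] := eqVneq c 0; last by rewrite divfK.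
by rewrite expr0n expn_eq0 !mulr0 -leqn0 leqNgt ltnW ?finNzRing_gt1 ?mul0r.
Qed.

Section NoCollineation.

Variables (s : nat) (sigma : {rmorphism K -> K}).
Variable f : {linear V -> V | sigma \; *:%R}.
Hypotheses (s_gt1 : (1 < s)%N) (s_lt : (s.+1 < n.+2)%N).
Hypotheses (sigma_bij : bijective sigma) (f_bij : bijective f).
Hypothesis f_center : forall v, v \in center -> f v \in center.
Hypothesis f_twist : forall x, exists c y, f (twist 1 x) = c *: twist s y.

Let fZ a v : f (a *: v) = sigma a *: f v.
Proof. exact: linearZ. Qed.

Let f0 : f 0 = 0.
Proof. exact: raddf0. Qed.

Let fD u v : f (u + v) = f u + f v.
Proof. exact: raddfD. Qed.

(** The eigenvalues at x, 1 and x + 1 are compared. If x^q = x, then [twist 1 x] is x times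
    [twist 1 1], and sigma(x) is again fixed by Frobenius. Otherwise these two vectors are
    independent over K, and additivity makes the three eigenvalues equal. *)
Lemma twist_eigen_uniform :
  exists gamma, forall x, twist_eigen s gamma (f (twist 1 x)).
Proof.
have eig x : exists gamma, twist_eigen s gamma (f (twist 1 x)).
  have [c [y ->]] := f_twist x; exists (c ^+ (q ^ s) / c).
  exact: twist_eigen_scale.
have [gamma1 eig1] := eig 1; exists gamma1 => x.
have [xq|xq] := eqVneq (x ^+ q) x.
  have -> : twist 1 x = x *: twist 1 1.
    apply: coord_inj => i; rewrite linearZ /= !coord_twist.
    by rewrite exprq_fix // expr1n mulr1.
  move=> i; rewrite fZ !linearZ /= exprMn eig1 mulrCA.
  by rewrite exprq_fix // -rmorphXn /= xq.
have [gamma eigx] := eig x; have [gamma' eigD] := eig (x + 1).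
suff /eqP -> : gamma1 == gamma by [].
have dep : (gamma' - gamma) *: f (twist 1 x) +
    (gamma' - gamma1) *: f (twist 1 1) = 0.
  apply: coord_inj => i; rewrite linear0 linearD !linearZ /= -(ord_predK i).
  rewrite !mulrBl -eigx -eig1 addrACA -mulrDr -linearD -fD -twistD -eigD.
  by rewrite twistD fD linearD exprqD -opprD subrr.
(* Through the inverse of sigma the scalars move inside f, whose injectivity yields a relation
   between [twist 1 x] and [twist 1 1]. *)
have [tau _ tauK] := sigma_bij.
move: dep; rewrite -(tauK (gamma' - gamma)) -(tauK (gamma' - gamma1)).
rewrite -!fZ -fD -f0.
move/(bij_inj f_bij) => dep.
have dep_i (i : 'I_n.+2) :
    tau (gamma' - gamma) * x ^+ (q ^ i) + tau (gamma' - gamma1) = 0.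
  have := congr1 (coord B i) dep; rewrite linear0 linearD !linearZ /=.
  by rewrite !coord_twist !mul1n expr1n mulr1.
(* Coordinates 0 and 1 of the relation differ by tau(gamma' - gamma) (x^q - x). *)
have c0 : tau (gamma' - gamma) = 0.
  have /eqP := etrans (dep_i (lift ord0 ord0)) (esym (dep_i ord0)).
  rewrite (inj_eq (addIr _)) /= expr1 -subr_eq0 -mulrBr mulf_eq0 subr_eq0.
  by rewrite (negPf xq) orbF => /eqP.
have := dep_i ord0; rewrite c0 mul0r add0r => /(congr1 sigma).
move/(congr1 sigma): c0; rewrite !tauK !rmorph0 => /eqP; rewrite subr_eq0.
by move=> /eqP <- /eqP; rewrite subr_eq0 eq_sym.
Qed.

(** Since f preserves the center, these coordinates see only the axis part of [twist 1 x]. *)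
Lemma coord_image_twist (i : 'I_n.+2) x : (i < 2)%N ->
  coord B i (f (twist 1 x)) =
    coord B i (f B`_0) * sigma x + coord B i (f B`_1) * sigma x ^+ q.
Proof.
move=> i_lt2; rewrite -(subrKC (axis_vec 1 x) (twist 1 x)) fD linearD /=.
rewrite (coord_center i_lt2 (f_center (twist_decomp 1 x))) addr0.
rewrite fD !fZ linearD !linearZ /= rmorphXn [_ * sigma x]mulrC.
by rewrite [_ * sigma x ^+ _]mulrC.
Qed.

Lemma twisted_not_collinear : False.
Proof.
have [gamma eig] := twist_eigen_uniform.
pose i1 : 'I_n.+2 := lift ord0 ord0.
have S0 : ordS (ord0 : 'I_n.+2) = i1 by apply: val_inj; rewrite /= modn_small.
pose a (i : 'I_n.+2) j := coord B i (f B`_j).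
(* Exponents and coefficients of (a y + b y^q)^(q^s) - gamma (c y + d y^q). *)
pose h := nth 0%N [:: s; s.+1; 0; 1]%N.
pose co := nth 0 [:: a ord0 0 ^+ (q ^ s); a ord0 1 ^+ (q ^ s);
                     - (gamma * a i1 0); - (gamma * a i1 1)].
have co0 : forall i : 'I_4, co i = 0.
  apply: (linearized_eq0 (h := fun i : 'I_4 => h i)).
  - move=> i j /eqP; rewrite nth_uniq // => [/eqP/val_inj //|].
    by rewrite /= !inE; lia.
  - by case=> [[|[|[|[|]]]]] //= _; rewrite /h /= dimK; lia.
  move=> y; have [tau _ tauK] := sigma_bij.
  have := eig (tau y) ord0; rewrite S0 !coord_image_twist // tauK.
  rewrite exprqD !exprMn -exprM -expnS.
  rewrite !big_ord_recl big_ord0 /co /h /= expr1 expn1 addr0 !mulNr -!mulrA.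
  by rewrite -opprD -mulrDr addrA => ->; rewrite subrr.
have a0 (j : 'I_2) : a ord0 j = 0.
  case: j => [[|[|]]] //= _; apply/eqP; rewrite -(exprq_eq0 s); apply/eqP.
    exact: (co0 ord0).
  exact: (co0 (lift ord0 ord0)).
(* Coordinate 0 of f vanishes on B_0 and B_1 by [a0] and on the other B_i because f preserves the
   center, yet it is 1 at the preimage of B_0. *)
have [g _ gK] := f_bij.
have := coord_free ord0 ord0 (basis_free basisB); rewrite /= -(gK B`_0).
rewrite (coord_basis basisB (memvf (g B`_0))) (big_morph f fD f0).
rewrite linear_sum big1 => [/eqP|].
  by rewrite eq_sym oner_eq0.
move=> i _; rewrite fZ linearZ /=; have [i_lt2|i_gt1] := ltnP i 2.
  by have := a0 (Ordinal i_lt2); rewrite /a /= => ->; rewrite mulr0.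
by rewrite (coord_center _ (f_center (basis_center i_gt1))) ?mulr0.
Qed.

End NoCollineation.

(** This passes from points to vectors; a point fixes its vector only up to the scalar c of
    [f_twist]. *)
Lemma no_collineation s : (1 < s)%N -> (s.+1 < n.+2)%N ->
  ~ exists phi : {vspace V} -> {vspace V},
      [/\ collineation phi, phi @` points center = points center
        & phi @` twisted_subgeometry 1 = twisted_subgeometry s].
Proof.
move=> s_gt1 s_lt [phi [[sigma [f [sigma_bij f_bij [_ phiE]]]]]].
move=> phi_center phi_sub.
apply: (twisted_not_collinear s_gt1 s_lt sigma_bij f_bij).
- move=> v v_center; have [->|v_neq0] := eqVneq v 0; first by rewrite raddf0 mem0v.
  have : points center (phi <[v]>%VS).
    rewrite -phi_center; exists <[v]>%VS => //; split; last by rewrite -memvE.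
    by rewrite /has_pdim dim_vline v_neq0.
  by rewrite phiE // => -[_]; rewrite -memvE.
move=> x; have [->|x_neq0] := eqVneq x 0.
  exists 0, 0; have /eqP -> : twist 1 0 == 0 by rewrite twist_eq0.
  by rewrite raddf0 scale0r.
have : twisted_subgeometry s (phi <[twist 1 x]>%VS).
  by rewrite -phi_sub; exists <[twist 1 x]>%VS => //; exists x.
rewrite phiE ?twist_eq0 // => -[y _ fy].
by have := memv_line (f (twist 1 x)); rewrite -fy => /vlineP[c fx]; exists c, y.
Qed.

Lemma center_axis_disjoint : points center `&` points axis = set0.
Proof.
apply/seteqP; split=> // P [[dimP P_center] [_ P_axis]].
have : (P <= center :&: axis)%VS by rewrite subv_cap P_center.
by rewrite center_cap_axis subv0 => /eqP P0; move: dimP; rewrite /has_pdim P0 dimv0.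
Qed.

End TwistedSubgeometry.

(** * A basis adapted to the line Lambda *)

Section AxisBasis.

Variables (K : fieldType) (V : vectType K) (n : nat).
Variable h : {linear 'rV[K]_2 -> V}.

(** B_0 and B_1 are the images of the unit row vectors, completed by a basis of a complement of
    Lambda. *)
Lemma extend_row2 (Lambda : {vspace V}) : injective h ->
    (forall u, u \in Lambda -> exists w, u = h w) ->
    \dim Lambda = 2 -> \dim {:V} = n.+2 ->
  exists B : n.+2.-tuple V,
    [/\ basis_of {:V} B, <<take 2 B>>%VS = Lambda,
        \dim <<drop 2 B>> = n
      & forall a b : K, h (\row_(i < 2) [:: a; b]`_i) = a *: B`_0 + b *: B`_1].
Proof.
move=> h_inj h_onto dimL dimV.
pose e i := h (delta_mx 0 i).
have hE w : h w = w 0 0 *: e 0 + w 0 1 *: e 1.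
  rewrite {1}[w]row_sum_delta linear_sum !big_ord_recl big_ord0 addr0.
  by rewrite !linearZ; congr (_ *: h _ + w _ _ *: h (delta_mx _ _)); apply: val_inj.
have basisL : basis_of Lambda [:: e 0; e 1].
  rewrite basisEdim dimL leqnn andbT; apply/subvP => u /h_onto[w ->].
  by rewrite hE memvD // memvZ // memv_span ?inE ?eqxx ?orbT.
have basisV : basis_of {:V} ([:: e 0; e 1] ++ vbasis Lambda^C).
  rewrite -(addv_complf Lambda); apply: cat_basis => //; last exact: vbasisP.
  by apply/directv_addP/capv_compl.
have sizeB : size ([:: e 0; e 1] ++ vbasis Lambda^C) == n.+2.
  by rewrite /= size_tuple dimv_compl dimV dimL subn2.
exists (Tuple sizeB); split=> //=.
- by rewrite take0 (span_basis basisL).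
- by rewrite drop0 (span_basis (vbasisP _)) dimv_compl dimV dimL subn2.
by move=> a b; rewrite hE !mxE.
Qed.

End AxisBasis.

Theorem corollary4p6 (F : finFieldType) (K : fieldExtType F) (t : nat)
    (dimK : \dim {:K} = t) (ht : t = 5%N \/ (6 < t)%N)
    (V : vectType K) (dimV : has_pdim (t - 1) {:V})
    (Lambda : {vspace V}) (dimLambda : has_pdim 1 Lambda)
    (iota : 'Hom('rV[K]_2, V)) (iota_inj : lker iota = 0%VS)
    (iota_img : limg iota = Lambda)
    (L : set {vspace 'rV[K]_2}) (hL : pseudoregulus_type L) :
  let L' := [set (iota @: P)%VS | P in L] in
  exists (Gamma : {vspace V}) (Sigma1 Sigma2 : set {vspace V}),
    [/\ has_pdim (t - 3) Gamma,
        points Gamma `&` points Lambda = set0,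
        Sigma1 <> Sigma2,
        [/\ canonical_subgeometry Sigma1,
            canonical_subgeometry Sigma2,
            Sigma1 `&` points Gamma = set0
          & Sigma2 `&` points Gamma = set0]
      & [/\ projection Gamma Lambda Sigma1 = L',
            L' = projection Gamma Lambda Sigma2
          & ~ exists phi : {vspace V} -> {vspace V},
                [/\ collineation phi,
                    phi @` points Gamma = points Gamma
                  & phi @` Sigma1 = Sigma2]]].
Proof.
move=> L'.
have [s [s_gt1 s_lt co_st]] := exists_coprime_step ht.
have [n tE] : exists n, t = n.+2 by exists (t - 2)%N; lia.
move: dimV; rewrite /has_pdim => dimV; have {}dimV : \dim {:V} = n.+2 by lia.
rewrite {t}tE in dimK ht s_lt co_st *.
case: hL => phi [g [g_bij [_ phiE]]] LE.
have iotaI : injective iota by apply/lker0P; rewrite iota_inj.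
(* The projectivity from the model to L is absorbed into the basis, so that L' consists of the
   points of [axis_vec B 1]. *)
pose h : {linear 'rV[K]_2 -> V} := iota \o g.
have h_inj : injective h by apply: inj_comp; last exact: bij_inj.
have [|B [basisB axisB dim_center hE]] :=
    @extend_row2 _ _ _ h Lambda h_inj _ dimLambda dimV.
  rewrite -iota_img => u /memv_imgP[v _ ->]; have [g' _ gK] := g_bij.
  by exists (g' v); rewrite /= gK.
have L'E : L' = projection (center B) Lambda (twisted_subgeometry B 1).
  rewrite -axisB projection_twisted //.
  have lineE l : l != 0 ->
      (iota @: phi <[\row_(i < 2) [:: l; l ^+ #|F|]`_i]>)%VS =
      <[axis_vec B 1 l]>%VS.
    move=> l_neq0; rewrite phiE ?limg_line; first by have /= -> := hE l (l ^+ #|F|).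
    apply: contraNneq l_neq0 => /rowP/(_ 0); rewrite !mxE /= => ->; exact: eqxx.
  rewrite /L' -LE; apply/seteqP; split=> P.
    by move=> [_ [_ [l l_neq0 <-] <-] <-]; exists l; rewrite ?lineE.
  move=> [l l_neq0 <-]; rewrite -lineE //.
  by eexists; [eexists; [exists l |] |].
have co1 : coprime 1 n.+2 by rewrite coprime1n.
have no_phi := no_collineation dimK basisB s_gt1 s_lt.
exists (center B), (twisted_subgeometry B 1), (twisted_subgeometry B s).
split.
- by rewrite /has_pdim dim_center; lia.
- by rewrite -axisB center_axis_disjoint.
(* If the subgeometries coincided, the identity would be an excluded collineation. *)
- move=> sub_eq; apply: no_phi; exists idfun; split; rewrite ?image_id //.
  exists idfun, idfun; split; try by exists idfun.
  by split=> //; exact: set_bij_id.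
- by split; [exact: twisted_canonical | exact: twisted_canonical
            | exact: twisted_center_disjoint | exact: twisted_center_disjoint].
split=> //; rewrite L'E -axisB !projection_twisted //.
by rewrite axis_points_coprime // ltnW.
Qed.
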